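(* Let $\bar{\boldsymbol C}\subset\mathbb{R}^3$ be a $3$-faced polyhedral cone and let $\bar P=P_{\bar\xi,\bar{\boldsymbol C}}$ be a pyramid, where $\bar\xi\in\mathbb{S}^2$. Let $\boldsymbol C$ be another $3$-faced polyhedral cone which has less dihedral angle than $\bar{\boldsymbol C}$. Then there is a unit vector $\xi$ in the interior of $\boldsymbol C^*$ such that $$E_{\bar P}(P_{\xi,\boldsymbol C})\le0 .$$ If moreover $\boldsymbol C$ is not isometric to $\bar{\boldsymbol C}$, then $\xi$ can be chosen so that the inequality is strict.
   Context: A polyhedral cone in $\mathbb{R}^3$ is a set of the form $\boldsymbol C=\{x: x\cdot n_j\le0,\ 1\le j\le k\}$; its polar cone is $\boldsymbol C^*=\{x: x\cdot y\le0\ \forall y\in\boldsymbol C\}$. $\boldsymbol C$ is non-degenerate if $\boldsymbol C$ and $\boldsymbol C^*$ both have non-empty interior. A $k$-faced polyhedral cone is a non-degenerate polyhedral cone with exactly $k$ two-dimensional faces $F_1,\dots,F_k$; $n_j$ is the unit normal of $F_j$ pointing out of $\boldsymbol C$, and the faces are cyclically ordered (indices mod $k$) so that $\det(n_j,n_{j+1},n_{j+2})<0$; then $F_j\cap F_{j+1}=\{ru_j:r\ge0\}$ with $u_j=\frac{n_j\times n_{j+1}}{|n_j\times n_{j+1}|}$. The dihedral angle is $\theta_j=\measuredangle F_jF_{j+1}=\pi-\measuredangle(n_j,n_{j+1})$. Bars denote the corresponding quantities for $\bar{\boldsymbol C}$. $\boldsymbol C$ has less dihedral angle than $\bar{\boldsymbol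 C}$ if $\theta_j\le\bar\theta_j$ for all $j$. $\boldsymbol C$ and $\bar{\boldsymbol C}$ are isometric if $\Omega(\bar{\boldsymbol C})=\boldsymbol C$ for some orthogonal matrix $\Omega$. For $\xi\in\mathbb{S}^2$, $P_{\xi,\boldsymbol C}=\{x\in\boldsymbol C: x\cdot\xi\ge-1\}$; it is called a pyramid if it is bounded (which happens exactly when $\xi$ lies in the interior of $\boldsymbol C^*$). Its base face is $B=\{x\in\boldsymbol C:x\cdot\xi=-1\}$, with inner unit normal $\xi$, and $\gamma_j=\measuredangle(n_j,\xi)\in(0,\pi)$ is the dihedral angle between $F_j$ and $B$. For the reference pyramid $\bar P$, $\bar\gamma_j=\measuredangle(\bar n_j,\bar\xi)$. The energy of a pyramid $P=P_{\xi,\boldsymbol C}$ relative to $\bar P$ is $$E_{\bar P}(P)=|B|-\sum_{j=1}^k\cos\bar\gamma_j\,|F_j\cap P|,$$ where $|\cdot|$ denotes area. *)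

(* Defs.v *)
From HB Require Import structures.
From mathcomp Require Import all_boot all_order all_algebra.
From mathcomp Require Import all_classical all_reals all_analysis.

Set Implicit Arguments.
Unset Strict Implicit.
Unset Printing Implicit Defensive.

Import Order.TTheory GRing.Theory Num.Theory.
Import numFieldNormedType.Exports.

Local Open Scope classical_set_scope.
Local Open Scope ring_scope.

Section Geometry.
Context {R : realType}.

(* Points of R^3 are row vectors. The library norm on 'rV[R]_3 is the sup norm;
   it is used only through the topology and boundedness, which do not depend
   on the choice of norm. *)
Notation vec := 'rV[R]_3.

Implicit Types (x y u v : vec) (A C : set vec).

Definition dot u v : R := \sum_i u 0 i * v 0 i.

Definition enorm u : R := Num.sqrt (dot u u).

Definition unit_vec u : Prop := enorm u = 1.

Definition angle u v : R := acos (dot u v / (enorm u * enorm v)).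

Definition det3 u v w : R := \det (\matrix_(i < 3) [:: u; v; w]`_i).

(* [area A] is for subsets of a plane: the Lebesgue measure of A in orthonormal
   coordinates (p; e1, e2) of a plane containing A. The value does not depend
   on which coordinates [get] selects. Areas are real numbers; [fine] is only
   meant for bounded sets. *)
Definition plane_chart (f : vec * vec * vec) (st : R * R) : vec :=
  let: (p, e1, e2) := f in p + st.1 *: e1 + st.2 *: e2.

Definition orthonormal_plane_frame (f : vec * vec * vec) : Prop :=
  let: (_, e1, e2) := f in [/\ unit_vec e1, unit_vec e2 & dot e1 e2 = 0].

Definition area A : R :=
  let f := get [set f : vec * vec * vec |
                 orthonormal_plane_frame f /\ A `<=` range (plane_chart f)] in
  fine ((@lebesgue_measure R \x @lebesgue_measure R)%E (plane_chart f @^-1` A)).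

(* Dimension of the linear span of A. *)
Definition has_dim A (d : nat) : Prop :=
  exists U : {vspace vec},
    [/\ \dim U = d,
        forall x, A x -> x \in U
      & forall V : {vspace vec}, (forall x, A x -> x \in V) -> (U <= V)%VS].

Definition polyhedral_cone C : Prop :=
  exists (k : nat) (n : 'I_k -> vec), C = [set x | forall j, dot x (n j) <= 0].

Definition polar C : set vec := [set x | forall y, C y -> dot x y <= 0].

Definition nondegenerate C : Prop := C° !=set0 /\ (polar C)° !=set0.

Definition cone_face C A : Prop :=
  exists2 m, polar C m & A = C `&` [set x | dot x m = 0].

(* Consecutive faces meeting in an edge, and the sign of the determinant, say
   that the faces are listed in their (oriented) cyclic order. [ordS] is the
   successor modulo k. *)
Record faced_cone (k : nat) := FacedCone {
  cone :> set vec;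
  face : 'I_k -> set vec;
  normal : 'I_k -> vec;
  cone_polyhedral : polyhedral_cone cone;
  cone_nondegenerate : nondegenerate cone;
  face_inj : injective face;
  range_face : range face = [set A | cone_face cone A /\ has_dim A 2];
  normal_unit : forall j, unit_vec (normal j);
  normal_orthogonal : forall j x, face j x -> dot x (normal j) = 0;
  normal_outward : forall j x, cone x -> dot x (normal j) <= 0;
  face_cyclic : forall j, has_dim (face j `&` face (ordS j)) 1;
  normal_cyclic : forall j,
    det3 (normal j) (normal (ordS j)) (normal (ordS (ordS j))) < 0
}.

Definition dihedral k (C : faced_cone k) (j : 'I_k) : R :=
  pi - angle (normal C j) (normal C (ordS j)).

Definition less_dihedral_angle k (C Cbar : faced_cone k) : Prop :=
  forall j, dihedral C j <= dihedral Cbar j.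

(* x *m Omega^T is Omega applied to the column vector x. *)
Definition isometric C Cbar : Prop :=
  exists2 Omega : 'M[R]_3, Omega *m Omega^T = 1%:M &
    [set x *m Omega^T | x in Cbar] = C.

Definition truncation (xi : vec) C : set vec :=
  C `&` [set x | -1 <= dot x xi].

Definition is_pyramid (xi : vec) C : Prop :=
  unit_vec xi /\ bounded_set (truncation xi C).

Definition base_face (xi : vec) C : set vec :=
  C `&` [set x | dot x xi = -1].

(* The energy of the pyramid P_{xi, C} relative to P_{xibar, Cbar}. *)
Definition energy k (xibar : vec) (Cbar : faced_cone k)
    (xi : vec) (C : faced_cone k) : R :=
  area (base_face xi C)
  - \sum_(j < k) cos (angle (normal Cbar j) xibar)
                 * area (face C j `&` truncation xi C).

End Geometry.

Arguments faced_cone : clear implicits.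

(* Main.v *)
Require Import Defs.
From HB Require Import structures.
From mathcomp Require Import all_boot all_order all_algebra.
From mathcomp Require Import all_classical all_reals all_analysis.
From mathcomp Require Import ring lra measurable_realfun.

(** The normals n_j of a three-faced cone form a basis, so a vector is given
by its three coordinates in it, and the outward area vectors of a pyramid add
up to zero: |B| xi = sum_j |F_j n P| n_j. Hence, writing xi = sum_j b_j n_j, the
pyramid has |F_j n P| = |B| b_j ([area_face], [area_base]), and
  E = |B| (1 - sum_j b_j cos gamma_j),
where gamma_j is the angle between the reference normal nbar_j and xibar.

Let b_j be the coordinates of xibar in the basis of the nbar_j; they are
positive because the reference pyramid is bounded ([coef_pos_of_pyramid]).
Transplant them to the other cone: y = sum_j b_j n_j and xi = y / |y|, which
lies in the interior of the polar cone ([interior_polar]). As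
sum_j b_j (nbar_j . xibar) = |xibar|^2 = 1, the energy is |B| (1 - 1 / |y|),
and it remains to compare |y| with 1. Expanding both squared norms,
  1 - |y|^2 = 2 sum_j b_j b_(j+1) (nbar_j . nbar_(j+1) - n_j . n_(j+1)),
since for three faces every pair of normals is a pair of consecutive ones.
Smaller dihedral angles mean larger angles between normals, so each term is
nonnegative ([dot_le_of_dihedral]). If all of them vanish, the two bases of
normals have the same Gram matrix and the cones are isometric
([isometric_of_dot]).

Two ingredients support this. A cone with prescribed faces has to be
recognized as the intersection of the three half-spaces bounded by its faces
([cone_normals], [face_normals]), which is extracted from an irredundant
half-space description ([facet_of_active]). Areas are computed from the
planar Lebesgue measure of a triangle ([product_lebesgue_triangle]) and turned
into the length of a cross product ([area_triangle], [gram_cross]). *)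

Set Implicit Arguments.
Unset Strict Implicit.
Unset Printing Implicit Defensive.

Import Order.TTheory GRing.Theory Num.Theory.
Import numFieldNormedType.Exports.

Local Open Scope classical_set_scope.
Local Open Scope ring_scope.

(** * Areas of plane triangles *)

Section Planar.
Context {R : realType}.
Notation mu := (@lebesgue_measure R).
Notation RR := (measurableTypeR R).
Open Scope ereal_scope.

Lemma measurable_affine (a b : R) :
  measurable_fun [set: RR] ((fun y : R => a * y + b)%R : RR -> RR).
Proof.
by apply: measurable_funD => //; exact: measurable_funM.
Qed.

(** A measure on the line is determined by its values on half-open intervals,
whose preimages under an affine map are intervals with rescaled length. *)
Lemma lebesgue_measure_affine (a b : R) (A : set RR) :
  a != 0%R -> measurable A ->
  mu ((fun y : R => a * y + b)%R @^-1` A) = `|a|^-1%:E * mu A.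
Proof.
move=> a0 mA.
have na : (0 < `|a|)%R by rewrite normr_gt0.
have nn : (0 <= `|a|)%R by [].
pose f (y : RR) : RR := (a * y + b)%R.
suff h : mu A = `|a|%:E * pushforward mu f A.
  by rewrite h muleA -EFinM mulVf ?mul1e ?gt_eqF.
apply: (lebesgue_measure_unique (mu := mscale (NngNum nn) _)) => //=.
  exact: measurable_affine.
move=> mf _ [[x y]] _ <-; rewrite /mscale/= /pushforward /f {f mf}.
have [{}a0|{}a0] : (a < 0)%R \/ (0 < a)%R by case: (ltgtP a 0%R) a0; auto.
- rewrite (_ : _ @^-1` _ = `[((y - b) / a)%R, ((x - b) / a)%R[%classic).
    rewrite !lebesgue_measure_itv/= !lte_fin ltr_ndivrMr// divfK ?lt_eqF//.
    rewrite ltrD2r; case: ifP => _; last by rewrite mule0.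
    by rewrite -EFinD -EFinM ltr0_norm//; congr (_%:E); field; rewrite lt_eqF.
  apply/seteqP; split => z /=; rewrite !in_itv/= ler_ndivrMr// ltr_ndivlMr// mulrC;
  by rewrite -lerBrDr -ltrBlDr andbC.
- rewrite (_ : _ @^-1` _ = `]((x - b) / a)%R, ((y - b) / a)%R]%classic).
    rewrite !lebesgue_measure_itv/= !lte_fin ltr_pdivrMr// divfK ?gt_eqF//.
    rewrite ltrD2r; case: ifP => _; last by rewrite mule0.
    by rewrite -EFinD -EFinM gtr0_norm//; congr (_%:E); field; rewrite gt_eqF.
  apply/seteqP; split => z /=; rewrite !in_itv/= ler_pdivlMr// ltr_pdivrMr// mulrC;
  by rewrite -lerBrDr -ltrBlDr.
Qed.

(** A lower triangular map acts on each vertical section by an affine map of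
the line, and on the abscissas by another one; each contributes its factor. *)
Lemma product_lebesgue_lower_affine (a e c d f : R) (A : set (RR * RR)) :
  a != 0%R -> d != 0%R -> measurable A ->
  (mu \x mu) ((fun z : R * R => (a * z.1 + e, c * z.1 + d * z.2 + f)%R) @^-1` A)
  = (`|a|^-1 * `|d|^-1)%:E * (mu \x mu) A.
Proof.
move=> a0 d0 mA.
rewrite [LHS]/product_measure1 /=.
transitivity (\int[mu]_x ((`|d|^-1)%:E * mu (xsection A (a * x + e)%R))).
  apply: eq_integral => x _ /=.
  rewrite -(@lebesgue_measure_affine d (c * x + f)%R) //; last first.
    exact: measurable_xsection.
  congr (mu _); apply/seteqP; split => y /=; rewrite /xsection/= !inE/=;
  by rewrite addrAC addrC addrA.
have m1 : measurable_fun [set: RR] (mu \o xsection A).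
  exact: measurable_fun_xsection.
rewrite ge0_integralZl//; last first.
  exact: (measurableT_comp m1 (measurable_affine a e)).
rewrite -(ge0_integral_pushforward (measurable_affine a e) mu
  (D := setT) (f := mu \o xsection A)) //.
have ai : (0 <= `|a|^-1)%R by rewrite invr_ge0.
rewrite (eq_measure_integral (mscale (NngNum ai) mu)).
  rewrite ge0_integral_mscale//= muleA -EFinM.
  by congr (_%:E * _); rewrite mulrC.
  exact: measurable_affine.
by move=> mae B mB _; exact: lebesgue_measure_affine.
Qed.

(** The triangle with vertices (0, 0), (1, 0) and (h, 1): its horizontal section
at height y has length 1 - y whatever h is. *)
Definition skew_triangle (h : R) : set (RR * RR) :=
  [set z | [/\ 0 <= z.2, h * z.2 <= z.1 & z.1 + (1 - h) * z.2 <= 1]%R].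

Lemma measurable_skew_triangle h : measurable (skew_triangle h).
Proof.
have H (f : RR * RR -> RR) :
    measurable_fun setT f -> measurable [set z | (0 <= f z)%R].
  move=> mf; rewrite -[X in measurable X]setTI.
  rewrite (_ : [set z | _] = f @^-1` `[0%R, +oo[%classic); first exact: mf.
  by apply/seteqP; split => z /=; rewrite in_itv/= andbT.
rewrite (_ : skew_triangle h = [set z | (0 <= z.2)%R]
  `&` [set z | (0 <= z.1 - h * z.2)%R]
  `&` [set z | (0 <= 1 - (z.1 + (1 - h) * z.2))%R]).
  apply: measurableI; first apply: measurableI; apply: H => //.
    by apply: measurable_funB => //; apply: measurable_funM.
  apply: measurable_funB => //; apply: measurable_funD => //.
  exact: measurable_funM.
by apply/seteqP; split => z /=; rewrite !subr_ge0; [case|move=> [[]]].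
Qed.

(** Integrating the lengths of the horizontal sections, hence in the order
opposite to the one defining the product measure, gives the integral of 1 - y
over the unit interval. *)
Lemma product_lebesgue_skew_triangle h :
  (mu \x mu) (skew_triangle h) = (2^-1)%:E.
Proof.
have mT := measurable_skew_triangle h.
rewrite (product_measure_unique (m' := product_measure2 mu mu)) //; last first.
  by move=> *; exact: product_measure2E.
rewrite /product_measure2 /=.
transitivity (\int[mu]_(y in `[0%R, 1%R]) (1 - y)%:E).
  rewrite integral_mkcond; apply: eq_integral => y _ /=; rewrite patchE.
  rewrite (_ : ysection _ y = if (0 <= y)%R
    then `[(h * y)%R, (1 - (1 - h) * y)%R]%classic else set0).
    case: ifPn => y0.
      rewrite lebesgue_measure_itv /= lte_fin.
      have -> : (h * y < 1 - (1 - h) * y)%R = (y < 1)%R by apply/idP/idP; lra.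
      case: ifPn => y1.
        rewrite mem_set /= ?in_itv/= ?y0 ?ltW// -EFinD; congr (_%:E); ring.
      have [->|yn1] := eqVneq y 1%R; first by rewrite subrr if_same.
      rewrite memNset//= in_itv/= y0 /=; apply/negP; lra.
    rewrite measure0 memNset//= in_itv/=; apply/negP; lra.
  apply/seteqP; split => x; rewrite /ysection/= inE/= ; case: ifPn => // y0.
  - by move=> [_ /= h1 h2]; rewrite in_itv/= h1 /=; lra.
  - by move=> [/= h0]; rewrite h0 in y0.
  - by rewrite /= in_itv/= => /andP[h1 h2]; split => //=; lra.
pose F (y : R) := (y - 2^-1 * y ^+ 2)%R.
have dF (y : R) : is_derive y 1%R F (1 - y)%R.
  by rewrite /F; apply: is_derive_eq; rewrite /GRing.scale/=; field.
have cF : continuous F.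
  move=> y; apply: differentiable_continuous; apply/derivable1_diffP.
  by case: (dF y).
rewrite (continuous_FTC2 (F := F)) //.
- by rewrite -EFinD /F; congr (_%:E); field.
- apply: continuous_subspaceT => y; apply: cvgB; [exact: cvg_cst|exact: cvg_id].
- split=> [y _||]; first by case: (dF y).
    by apply: cvg_at_right_filter; exact: cF.
  by apply: cvg_at_left_filter; exact: cF.
- by move=> y _; rewrite derive1E; case: (dF y).
Qed.

Definition planar_triangle (p v w : R * R) : set (RR * RR) :=
  [set z | exists s t : R, [/\ 0 <= s, 0 <= t, s + t <= 1 &
     z = (p.1 + s * v.1 + t * w.1, p.2 + s * v.2 + t * w.2)]%R].

Lemma planar_triangleC p v w : planar_triangle p v w = planar_triangle p w v.
Proof.
apply/seteqP; split => z [s [t [s0 t0 st ->]]]; exists t, s; split => //.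
- by rewrite addrC.
- by rewrite addrAC [X in (_, X)]addrAC.
- by rewrite addrC.
- by rewrite addrAC [X in (_, X)]addrAC.
Qed.

(** A lower triangular affine map sends p to the origin and v to (1, 0), and
normalizes the height of w; the remaining abscissa h = w.1 / v.1 of w is free
in a skew triangle. *)
Lemma product_lebesgue_triangle p v w : (v.1 * w.2 - v.2 * w.1 != 0)%R ->
  (mu \x mu) (planar_triangle p v w) = (`|v.1 * w.2 - v.2 * w.1| / 2)%:E.
Proof.
(* The edges v and w play symmetric roles, and one has a nonzero abscissa. *)
wlog v10 : v w / v.1 != 0%R.
  move=> wl vw; have [v10|v10] := eqVneq v.1 0%R; last exact: (wl v w).
  rewrite planar_triangleC (wl w v).
  - by rewrite distrC; congr ((`|_| / 2)%:E); ring.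
  - by apply/eqP => w0; move: vw; rewrite v10 w0 mul0r mulr0 subrr eqxx.
  - by rewrite -oppr_eq0 opprB mulrC [(w.1 * _)%R]mulrC.
set d := (_ - _)%R => d0.
pose h := (w.1 / v.1)%R.
rewrite (_ : planar_triangle p v w =
  (fun z => (v.1^-1 * z.1 + - (v.1^-1 * p.1),
     - (v.2 / d) * z.1 + (v.1 / d) * z.2 + (v.2 * p.1 - v.1 * p.2) / d)%R)
  @^-1` skew_triangle h).
  rewrite product_lebesgue_lower_affine ?invr_neq0 ?mulf_neq0 ?invr_neq0//; last first.
    exact: measurable_skew_triangle.
  rewrite product_lebesgue_skew_triangle -EFinM; congr ((_ / 2)%:E).
  rewrite !normrM !normfV invrM ?unitfE ?invr_eq0 ?normr_eq0// !invrK.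
  by rewrite mulrCA divff ?mulr1 ?normr_eq0.
apply/seteqP; split => z.
- move=> [s [t [s0 t0 st ->]]].
  have e1 : (v.1^-1 * (p.1 + s * v.1 + t * w.1) + - (v.1^-1 * p.1) = s + h * t)%R.
    by rewrite /h; field.
  have e2 : (- (v.2 / d) * (p.1 + s * v.1 + t * w.1) +
     v.1 / d * (p.2 + s * v.2 + t * w.2) + (v.2 * p.1 - v.1 * p.2) / d = t)%R.
    by rewrite -[RHS](mulfK d0) {4}/d; field.
  rewrite /skew_triangle/= e1 e2; split; lra.
- rewrite /skew_triangle /=; set t := (_ + _)%R; set s := (_ + _)%R => -[t0 h1 h2].
  exists (s - h * t)%R, t; split; [lra|lra|lra|].
  rewrite [LHS]surjective_pairing; congr (_, _); rewrite /s /t /h.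
  + by field; rewrite d0.
  + by rewrite /d; field; rewrite v10 -/d d0.
Qed.
End Planar.

(** * Scalar products and triangles in space *)

Section Space.
Context {R : realType}.
Notation vec := 'rV[R]_3.
Implicit Types (p u v w x y : vec) (a b s t : R).

Lemma dotE u v :
  dot u v = u 0 0 * v 0 0 + u 0 1 * v 0 1 + u 0 2%:R * v 0 2%:R.
Proof.
rewrite /dot !big_ord_recr big_ord0 /= add0r.
by congr (u 0 _ * v 0 _ + u 0 _ * v 0 _ + u 0 _ * v 0 _); apply: val_inj.
Qed.

Lemma dotC u v : dot u v = dot v u.
Proof. by rewrite /dot; apply: eq_bigr => i _; rewrite mulrC. Qed.

Lemma dotDl u v w : dot (u + v) w = dot u w + dot v w.
Proof.
by rewrite /dot -big_split; apply: eq_bigr => i _; rewrite mxE mulrDl.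
Qed.

Lemma dotZl a u v : dot (a *: u) v = a * dot u v.
Proof.
by rewrite /dot mulr_sumr; apply: eq_bigr => i _; rewrite mxE mulrA.
Qed.

Lemma dotDr u v w : dot w (u + v) = dot w u + dot w v.
Proof. by rewrite dotC dotDl !(dotC w). Qed.

Lemma dotZr a u v : dot v (a *: u) = a * dot v u.
Proof. by rewrite dotC dotZl dotC. Qed.

Lemma dotNl u v : dot (- u) v = - dot u v.
Proof. by rewrite -scaleN1r dotZl mulN1r. Qed.

Lemma dotNr u v : dot u (- v) = - dot u v.
Proof. by rewrite dotC dotNl dotC. Qed.

Lemma dot0l u : dot 0 u = 0.
Proof. by rewrite -(scale0r 0) dotZl mul0r. Qed.

Lemma dot_suml k (F : 'I_k -> vec) u : dot (\sum_i F i) u = \sum_i dot (F i) u.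
Proof.
apply: (big_ind2 (fun x r => dot x u = r)) => //; first exact: dot0l.
by move=> x r y s; rewrite dotDl => -> ->.
Qed.

Lemma dot_ge0 u : 0 <= dot u u.
Proof. by rewrite /dot sumr_ge0// => i _; rewrite -expr2 sqr_ge0. Qed.

Lemma dot_eq0 u : (dot u u == 0) = (u == 0).
Proof.
apply/idP/eqP => [/eqP|->]; last by rewrite dot0l.
move=> /psumr_eq0P u0; apply/rowP => i; rewrite mxE.
apply/eqP; have := u0 (fun i _ => ltac:(by rewrite -expr2 sqr_ge0)) i isT.
by move=> /eqP; rewrite mulf_eq0 orbb.
Qed.

Lemma dot_gt0 u : (0 < dot u u) = (u != 0).
Proof. by rewrite lt_def dot_ge0 andbT dot_eq0. Qed.

Lemma sqr_enorm u : enorm u ^+ 2 = dot u u.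
Proof. by rewrite /enorm sqr_sqrtr// dot_ge0. Qed.

Lemma unit_dot u : unit_vec u <-> dot u u = 1.
Proof.
rewrite /unit_vec; split=> [h|h]; first by rewrite -sqr_enorm h expr1n.
by rewrite /enorm h sqrtr1.
Qed.

Definition gram_det u v := dot u u * dot v v - dot u v ^+ 2.

Definition triangle p v w : set vec :=
  [set x | exists s t : R, [/\ 0 <= s, 0 <= t, s + t <= 1 &
     x = p + s *: v + t *: w]].

Lemma unit_normalize u : u != 0 -> unit_vec ((enorm u)^-1 *: u).
Proof.
move=> u0; apply/unit_dot; rewrite dotZl dotZr -sqr_enorm.
have : enorm u != 0 by rewrite -sqrf_eq0 sqr_enorm dot_eq0.
by move=> ?; field.
Qed.

(** Gram-Schmidt orthonormalization of the edges v and w. *)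
Lemma triangle_frame p v w : 0 < gram_det v w -> exists f : vec * vec * vec,
  orthonormal_plane_frame f /\ triangle p v w `<=` range (plane_chart f).
Proof.
move=> g0; have v0 : v != 0.
  by apply: contraTneq g0 => ->; rewrite /gram_det !dot0l mul0r expr0n subr0 ltxx.
have nv : dot v v != 0 by rewrite dot_eq0.
pose e1 := (enorm v)^-1 *: v.
pose z := w - (dot v w / dot v v) *: v.
have vz : dot v z = 0 by rewrite /z dotDr dotNr dotZr divfK// subrr.
have z0 : z != 0.
  rewrite -dot_gt0 {1}/z dotDl dotNl dotZl vz mulr0 subr0 /z dotDr dotNr dotZr.
  rewrite (_ : _ - _ = gram_det v w / dot v v) ?divr_gt0 ?dot_gt0//.
  by rewrite /gram_det (dotC w v); field.
pose e2 := (enorm z)^-1 *: z.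
have n1 : enorm v != 0 by rewrite -sqrf_eq0 sqr_enorm.
have n2 : enorm z != 0 by rewrite -sqrf_eq0 sqr_enorm dot_eq0.
exists (p, e1, e2); split.
  by split; [exact: unit_normalize|exact: unit_normalize|rewrite dotZl dotZr vz !mulr0].
move=> x [s [t [s0 t0 st ->]]].
exists (s * enorm v + t * (dot v w / dot v v) * enorm v, t * enorm z) => //=.
rewrite /e1 /e2 !scalerA !mulrDl !mulfK// -!addrA; congr (_ + _).
rewrite scalerDl -addrA; congr (_ + _).
by rewrite /z scalerDr scalerN scalerA addrC subrK.
Qed.

(** In any orthonormal frame of the plane, the square of the determinant of the
coordinates of v and w is their Gram determinant, so that the value does not
depend on the frame chosen by [area]. *)
Lemma area_triangle p v w : 0 < gram_det v w ->
  area (triangle p v w) = Num.sqrt (gram_det v w) / 2.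
Proof.
move=> g0; rewrite /area /=.
set S := [set f | _]; have : S (get S) by apply: getPex; exact: triangle_frame.
move: (get S) => [[q e1] e2] [] [] /unit_dot e11 /unit_dot e22 e12 sub.
have e21 : dot e2 e1 = 0 by rewrite dotC.
have inT s t : 0 <= s -> 0 <= t -> s + t <= 1 -> triangle p v w (p + s *: v + t *: w).
  by move=> *; exists s, t.
have [|[p1 p2] _ /= pE] := sub p.
  by have := inT 0 0 (lexx _) (lexx _); rewrite !scale0r !addr0; apply.
have [|[v1 v2] _ /= vE] := sub (p + v).
  by have := inT 1 0 ler01 (lexx _); rewrite scale1r scale0r !addr0; apply.
have [|[w1 w2] _ /= wE] := sub (p + w).
  by have := inT 0 1 (lexx _) ler01; rewrite scale1r scale0r !addr0 add0r; apply.
(* The coordinates of the vertices give those of the edges. *)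
have {}vE : v = (v1 - p1) *: e1 + (v2 - p2) *: e2.
  by rewrite -(addKr p v) -vE -pE !scalerBl; apply/rowP => i; rewrite !mxE; ring.
have {}wE : w = (w1 - p1) *: e1 + (w2 - p2) *: e2.
  by rewrite -(addKr p w) -wE -pE !scalerBl; apply/rowP => i; rewrite !mxE; ring.
move: (v1 - p1) (v2 - p2) (w1 - p1) (w2 - p2) vE wE => {}v1 {}v2 {}w1 {}w2 vE wE.
have gE : gram_det v w = (v1 * w2 - v2 * w1) ^+ 2.
  rewrite /gram_det vE wE !(dotDl, dotDr, dotZl, dotZr) e11 e22 e12 e21; ring.
have d0 : v1 * w2 - v2 * w1 != 0 by rewrite -sqrf_eq0 -gE gt_eqF.
rewrite (_ : _ @^-1` _ = planar_triangle (p1, p2) (v1, v2) (w1, w2)).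
  by rewrite product_lebesgue_triangle//= gE sqrtr_sqr.
apply/seteqP; split => -[z1 z2] /= [s [t [s0 t0 st zE]]]; exists s, t; split => //=.
- have zE' : (z1 - (p1 + s * v1 + t * w1)) *: e1 +
      (z2 - (p2 + s * v2 + t * w2)) *: e2 = 0.
    rewrite !scalerBl !scalerDl -!scalerA.
    move: zE; rewrite -pE vE wE => /eqP; rewrite -subr_eq0 => /eqP <-.
    by apply/rowP => i; rewrite !mxE; ring.
  have := congr1 (dot ^~ e1) zE'; have := congr1 (dot ^~ e2) zE'.
  rewrite /= !(dotDl, dotZl) e11 e22 e12 e21 !dot0l !mulr0 !mulr1 add0r addr0.
  by move=> /eqP; rewrite subr_eq0 => /eqP -> /eqP; rewrite subr_eq0 => /eqP ->.
- case: zE => -> ->; rewrite -pE vE wE.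
  by apply/rowP => i; rewrite !mxE; ring.
Qed.
End Space.

(** * Cross products and dual bases *)

Section Cross.
Context {R : realType}.
Notation vec := 'rV[R]_3.
Implicit Types (p u v w x y a b c : vec).

Definition cross u v : vec := \row_i
  [:: u 0 1 * v 0 2%:R - u 0 2%:R * v 0 1;
      u 0 2%:R * v 0 0 - u 0 0 * v 0 2%:R;
      u 0 0 * v 0 1 - u 0 1 * v 0 0]`_i.

Lemma row3P x y : x 0 0 = y 0 0 -> x 0 1 = y 0 1 -> x 0 2%:R = y 0 2%:R -> x = y.
Proof.
move=> h0 h1 h2; apply/rowP; case=> -[|[|[|//]]] hi.
- by rewrite (_ : Ordinal hi = 0) //; apply: val_inj.
- by rewrite (_ : Ordinal hi = 1) //; apply: val_inj.
- by rewrite (_ : Ordinal hi = 2%:R) //; apply: val_inj.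
Qed.

Lemma det3E u v w : det3 u v w = dot u (cross v w).
Proof.
have det22 (A : 'M[R]_2) : \det A = A 0 0 * A 1 1 - A 0 1 * A 1 0.
  rewrite (expand_det_row _ 0) !big_ord_recr big_ord0 /= add0r.
  rewrite /cofactor !det_mx11 !mxE /=.
  rewrite expr0 expr1 mul1r mulN1r mulrN.
  by congr (A _ _ * A _ _ - A _ _ * A _ _); apply: val_inj.
rewrite /det3 (expand_det_row _ 0) !big_ord_recr big_ord0 /= add0r.
rewrite /cofactor !det22 !mxE dotE !mxE /=.
have eq3 (i j : 'I_3) : val i = val j -> i = j by exact: val_inj.
rewrite (eq3 (widen_ord _ (widen_ord _ _)) 0) // (eq3 (widen_ord _ _) 1) //.
rewrite (eq3 ord_max 2%:R) // (eq3 (lift 0 0) 1) // (eq3 (lift 0 1) 2%:R) //.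
rewrite (eq3 (lift 1 0) 0) // (eq3 (lift 1 1) 2%:R) //.
rewrite (eq3 (lift 2%:R 0) 0) // (eq3 (lift 2%:R 1) 1) //.
ring.
Qed.

Lemma gram_cross u v : gram_det u v = dot (cross u v) (cross u v).
Proof. by rewrite /gram_det !dotE !mxE /=; ring. Qed.

Lemma det3C u v w : det3 u v w = det3 v w u.
Proof. by rewrite !det3E !dotE !mxE /=; ring. Qed.

Lemma cross_cross a b c : cross (cross c a) (cross a b) = det3 a b c *: a.
Proof. by rewrite det3E dotE; apply: row3P; rewrite !mxE /=; ring. Qed.

Lemma det3_cross_sum a b c x : det3 a b c *: x =
  dot x a *: cross b c + dot x b *: cross c a + dot x c *: cross a b.
Proof. by rewrite det3E !dotE; apply: row3P; rewrite !mxE /=; ring. Qed.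

Lemma det3_sum_cross a b c x : det3 a b c *: x =
  dot x (cross b c) *: a + dot x (cross c a) *: b + dot x (cross a b) *: c.
Proof. by rewrite det3E !dotE; apply: row3P; rewrite !mxE /=; ring. Qed.

Lemma dot_cross_l u v : dot u (cross u v) = 0.
Proof. by rewrite !dotE !mxE /=; ring. Qed.

Lemma dot_cross_r u v : dot v (cross u v) = 0.
Proof. by rewrite !dotE !mxE /=; ring. Qed.

Lemma crossZ (s t : R) u v : cross (s *: u) (t *: v) = (s * t) *: cross u v.
Proof. by apply: row3P; rewrite !mxE /=; ring. Qed.

Lemma cross_sub u v w : cross (v - u) (w - u) = cross v w + cross w u + cross u v.
Proof. by apply: row3P; rewrite !mxE /=; ring. Qed.

Lemma ordS3 (j : 'I_3) : ordS (ordS (ordS j)) = j.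
Proof. by case: j => -[|[|[|//]]] hj; apply: val_inj. Qed.

Lemma ord3P (i j : 'I_3) : [\/ j = i, j = ordS i | j = ordS (ordS i)].
Proof.
case: i j => -[|[|[|//]]] hi [[|[|[|//]]] hj];
first [by apply: Or31; apply: val_inj|by apply: Or32; apply: val_inj
      |by apply: Or33; apply: val_inj].
Qed.

Lemma sum3 (V : nmodType) (F : 'I_3 -> V) j :
  \sum_i F i = F j + F (ordS j) + F (ordS (ordS j)).
Proof.
have F0 : \sum_i F i = F 0 + F 1 + F 2%:R.
  rewrite !big_ord_recr big_ord0 /= add0r.
  by congr (F _ + F _ + F _); apply: val_inj.
rewrite F0; case: (ord3P 0 j) => ->; rewrite ?ordS3.
- by congr (F _ + F _ + F _); apply: val_inj.
- by rewrite -addrA addrC; congr (F _ + F _ + F _); apply: val_inj.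
- by rewrite addrC addrA; congr (F _ + F _ + F _); apply: val_inj.
Qed.

Implicit Types n : 'I_3 -> vec.

(** Up to a positive or negative factor, these are the directions of the edges
of the cone with normals n: [dual_basis n i] is orthogonal to the two normals
other than n i, and normalized by [dot_dual]. *)
Definition dual_basis n i : vec :=
  (det3 (n i) (n (ordS i)) (n (ordS (ordS i))))^-1 *:
  cross (n (ordS i)) (n (ordS (ordS i))).

Definition independent n := det3 (n 0) (n 1) (n 2%:R) != 0.

Lemma det3_ordS n j :
  det3 (n j) (n (ordS j)) (n (ordS (ordS j))) = det3 (n 0) (n 1) (n 2%:R).
Proof.
case: (ord3P 0 j) => ->; rewrite ?ordS3.
- by congr (det3 (n _) (n _) (n _)); apply: val_inj.
- by rewrite -det3C; congr (det3 (n _) (n _) (n _)); apply: val_inj.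
- by rewrite det3C; congr (det3 (n _) (n _) (n _)); apply: val_inj.
Qed.

Lemma dot_dual n i j : independent n -> dot (n j) (dual_basis n i) = (j == i)%:R.
Proof.
rewrite /independent -(det3_ordS n i) => D0; rewrite /dual_basis dotZr.
case: (ord3P i j) => ->.
- by rewrite eqxx -det3E mulVf.
- by rewrite dot_cross_l mulr0 -val_eqE; case: i {D0} => -[|[|[|//]]].
- by rewrite dot_cross_r mulr0 -val_eqE; case: i {D0} => -[|[|[|//]]].
Qed.

Lemma dual_expansion n x : independent n -> x = \sum_i dot x (n i) *: dual_basis n i.
Proof.
move=> n0; rewrite (sum3 _ 0) /dual_basis !det3_ordS !ordS3.
rewrite !scalerA ![_ * _^-1]mulrC -!scalerA -!scalerDr.
apply: (scalerI n0); rewrite scalerA divff // scale1r.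
by rewrite -(det3_ordS n 0) det3_cross_sum.
Qed.

Lemma basis_expansion n x : independent n ->
  x = \sum_i dot x (dual_basis n i) *: n i.
Proof.
move=> n0; rewrite (sum3 _ 0) /dual_basis !det3_ordS !ordS3 !dotZr.
rewrite -!scalerA -!scalerDr.
apply: (scalerI n0); rewrite scalerA divff // scale1r.
by rewrite -(det3_ordS n 0) det3_sum_cross.
Qed.

(** The plane spanned by two dual vectors is the one orthogonal to the third
normal; the factor is the same for the three pairs. *)
Lemma cross_dual n j : independent n ->
  cross (dual_basis n (ordS j)) (dual_basis n (ordS (ordS j))) =
  (det3 (n 0) (n 1) (n 2%:R))^-1 *: n j.
Proof.
move=> n0; rewrite /dual_basis crossZ !det3_ordS !ordS3 cross_cross det3_ordS scalerA.
by congr (_ *: _); field.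
Qed.
End Cross.

(** * Half-space description of a three-faced cone *)

Section Cones.
Context {R : realType}.
Notation vec := 'rV[R]_3.
Implicit Types (p u v w x y : vec) (A C : set vec).

Lemma dot_continuous w : continuous (fun x : vec => dot x w).
Proof.
have coordC (i : 'I_3) (c : R) : continuous (fun x : vec => x 0 i * c).
  move=> x; apply: continuousM; first exact: (@coord_continuous R 1 3 0 i x).
  exact: cst_continuous.
rewrite (_ : (fun x => dot x w) = (fun x : vec =>
    x 0 0 * w 0 0 + x 0 1 * w 0 1 + x 0 2%:R * w 0 2%:R)).
  move=> x; apply: (continuousD
    (f := fun x : vec => x 0 0 * w 0 0 + x 0 1 * w 0 1)); last exact: coordC.
  by apply: (continuousD (f := fun x : vec => x 0 0 * w 0 0)); exact: coordC.
by apply/funext => x; rewrite dotE.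
Qed.

Lemma interior_segment A c v : A° c -> exists2 e, 0 < e & A (c + e *: v).
Proof.
move=> /nbhs_ballP[e /= e0 sub].
exists (e / 2 / (`|v| + 1)).
  by rewrite !divr_gt0// ltr_wpDl.
apply: sub; rewrite -ball_normE /= opprD addNKr normrN normrZ.
have v1 : 0 < `|v| + 1 by rewrite ltr_wpDl.
rewrite ger0_norm ?ltW ?divr_gt0//.
rewrite mulrAC ltr_pdivrMr// -mulrA ltr_pM2l// mulrC.
have := normr_ge0 v; lra.
Qed.

Definition dotr w (x : vec) : R^o := dot x w.

Fact dotr_linear w : linear (dotr w).
Proof. by move=> a x y; rewrite /dotr dotDl dotZl. Qed.

HB.instance Definition _ w :=
  GRing.isLinear.Build R vec R^o _ (dotr w) (dotr_linear w).

Definition hyperplane w : {vspace vec} := lker (linfun (dotr w)).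

Lemma mem_hyperplane w x : (x \in hyperplane w) = (dot x w == 0).
Proof. by rewrite memv_ker lfunE. Qed.

Lemma dim_hyperplane w : w != 0 -> \dim (hyperplane w) = 2%N.
Proof.
move=> w0; pose f := linfun (dotr w).
have := limg_ker_dim f fullv; rewrite capfv -/(hyperplane w) dimvf /dim /= mul1n => h.
have d1 : (\dim (limg f) <= 1)%N by rewrite (leq_trans (dimvS (subvf _)))// dimvf.
have d0 : (0 < \dim (limg f))%N.
  rewrite lt0n dimv_eq0; apply: contraNneq w0 => f0.
  rewrite -dot_eq0; have : f w \in limg f by rewrite memv_img// memvf.
  by rewrite f0 memv0 lfunE.
have /eqP d : \dim (limg f) == 1%N by rewrite eqn_leq d1 d0.
by move: h; rewrite d addn1 => -[].
Qed.

(** The point z lies in the relative interior of the part of C on which the i-th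
constraint is active. That part therefore spans the whole plane orthogonal to
m i, so it is one of the faces of C; the normal of this face is then parallel
to m i, and an interior point of C fixes the sign of the factor. *)
Lemma facet_of_active (I : finType) (P : pred I) (m : I -> vec)
    (C : faced_cone R 3) i z :
  (C : set vec) = [set x | forall l, P l -> dot x (m l) <= 0] ->
  P i -> m i != 0 -> dot z (m i) = 0 ->
  (forall l, P l -> l != i -> dot z (m l) < 0) ->
  exists2 j, face C j = C `&` [set x | dot x (m i) = 0] &
    exists2 c, 0 < c & m i = c *: normal C j.
Proof.
move=> CE Pi mi0 zi zl.
(* Small displacements of z inside the plane stay in C. *)
have pert u : dot u (m i) = 0 -> exists2 e, 0 < e & cone C (z + e *: u).
  move=> ui.
  pose Q := [set x | forall l, P l -> l != i -> dot x (m l) <= 0].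
  have Qz : Q° z.
    suff : \forall x \near z, forall l, P l -> l != i -> dot x (m l) <= 0 by [].
    apply: (filter_forall (nbhs_filter z)) => l.
    case: (boolP (P l)) => [Pl|_]; last exact: nearW.
    case: (eqVneq l i) => [_|li]; first exact: nearW.
    near=> x => _ _; apply: ltW.
    by near: x; apply: (cvgr_lt (dot z (m l))); [exact: dot_continuous|exact: zl].
  have [e e0 Qe] := interior_segment u Qz.
  exists e => //; rewrite CE => l Pl; have [->|li] := eqVneq l i; last exact: Qe.
  by rewrite dotDl dotZl zi ui mulr0 addr0.
pose A := C `&` [set x | dot x (m i) = 0].
have Az : A z.
  split=> //; rewrite CE => l Pl; have [->|li] := eqVneq l i; first by rewrite zi.
  exact/ltW/zl.
have sA x : A x -> x \in hyperplane (m i) by rewrite mem_hyperplane => -[_ /= ->].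
have Amax (V : {vspace vec}) :
    (forall x, A x -> x \in V) -> (hyperplane (m i) <= V)%VS.
  move=> AV; apply/subvP => u; rewrite mem_hyperplane => /eqP ui.
  have [e e0 Cu] := pert u ui.
  have Au : A (z + e *: u) by split => //=; rewrite dotDl dotZl zi ui mulr0 addr0.
  have := AV _ Au; rewrite (rpredDl _ (AV _ Az)) => /(memvZ e^-1).
  by rewrite scalerA mulVf ?scale1r ?gt_eqF.
have fA : range (face C) A.
  rewrite range_face; split.
    by exists (m i); [move=> y; rewrite CE dotC; exact|].
  exists (hyperplane (m i)); split => //; exact: dim_hyperplane.
case: fA => j _ fj; exists j; first by rewrite fj.
have nz u : dot u (m i) = 0 -> dot u (normal C j) = 0.
  move=> ui; have [e e0 Cu] := pert u ui.
  have Au : face C j (z + e *: u).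
    by rewrite fj; split => //=; rewrite dotDl dotZl zi ui mulr0 addr0.
  have Az' : face C j z by rewrite fj.
  have := normal_orthogonal Au; rewrite dotDl (normal_orthogonal Az') add0r dotZl.
  by move=> /eqP; rewrite mulf_eq0 gt_eqF//= => /eqP.
have mm : dot (m i) (m i) != 0 by rewrite dot_eq0.
(* The part of the normal orthogonal to m i is orthogonal to itself by nz. *)
pose a := dot (normal C j) (m i) / dot (m i) (m i).
have na : normal C j = a *: m i.
  apply/eqP; rewrite -subr_eq0 -dot_eq0; set u := _ - _.
  have ui : dot u (m i) = 0 by rewrite dotDl dotNl dotZl divfK ?subrr.
  by rewrite {2}/u dotDr dotNr dotZr ui (nz _ ui) mulr0 subrr.
have a0 : a != 0.
  apply: contra_eq_neq (normal_unit C j) => a0.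
  by rewrite /unit_vec na a0 scale0r /enorm dot0l sqrtr0 eq_sym oner_eq0.
have [[c Cc] _] := cone_nondegenerate C.
have [e e0 Ce] := interior_segment (m i) Cc.
have ca : a > 0.
  have h1 : dot c (normal C j) <= 0 by apply: normal_outward; exact: interior_subset.
  have h2 : dot c (m i) < 0.
    have : dot (c + e *: m i) (m i) <= 0 by move: Ce; rewrite CE; exact.
    rewrite dotDl dotZl; have := mulr_gt0 e0 (_ : 0 < dot (m i) (m i)).
    by rewrite dot_gt0 => /(_ mi0); lra.
  by move: h1; rewrite na dotZr nmulr_lle0// => h; rewrite lt_def a0.
by exists a^-1; rewrite ?invr_gt0// na scalerA mulVf// scale1r.
Unshelve. all: by end_near. Qed.

(** In an irredundant half-space description of C each constraint is violated
alone by some point. The segment from it to an interior point of C crosses the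
boundary plane of the constraint at a point where all the others are strict,
so the constraint is a positive multiple of the one given by some normal. *)
Lemma cone_normals (C : faced_cone R 3) :
  (C : set vec) = [set x | forall j, dot x (normal C j) <= 0].
Proof.
apply/seteqP; split=> [x Cx j|x xC]; first exact: normal_outward.
have [k [m CE]] := cone_polyhedral C.
pose rep (I : {set 'I_k}) := `[< (C : set vec) =
  [set x | forall l, l \in I -> dot x (m l) <= 0] >].
have repT : rep (finset.setTfor 'I_k).
  apply/asboolP; rewrite CE; apply/seteqP.
  by split => y /= h l; [move=> _|]; apply: h; rewrite ?finset.in_setT.
have [I /minsetP[/asboolP IE Imin] _] := minset_exists repT.
have violated_alone i : i \in I -> exists2 y,
    0 < dot y (m i) & forall l, l \in I -> l != i -> dot y (m l) <= 0.
  move=> iI; apply: contrapT => H.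
  suff /Imin : rep (I :\ i).
    by move=> /(_ (subsetDl _ _))/setP/(_ i); rewrite !inE eqxx iI.
  apply/asboolP; rewrite IE; apply/seteqP; split => y /= h l.
    by rewrite !inE => /andP[_]; exact: h.
  move=> lI; have [->|li] := eqVneq l i; last by apply: h; rewrite !inE li.
  rewrite leNgt; apply/negP => yi; apply: H; exists y => // l' l'I l'i.
  by apply: h; rewrite !inE l'i.
have mI0 l : l \in I -> m l != 0.
  by move=> /violated_alone[y + _]; apply: contraTneq => ->; rewrite dotC dot0l ltxx.
have [[c Cc] _] := cone_nondegenerate C.
have cI l : l \in I -> dot c (m l) < 0.
  move=> lI; have [e e0 Ce] := interior_segment (m l) Cc.
  have : dot (c + e *: m l) (m l) <= 0 by move: Ce; rewrite IE; exact.
  rewrite dotDl dotZl; have := mulr_gt0 e0 (_ : 0 < dot (m l) (m l)).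
  by rewrite dot_gt0 => /(_ (mI0 _ lI)); lra.
rewrite IE => i iI; have [y yi yl] := violated_alone i iI.
have [j _ [a a0 ->]] : exists2 j, face C j = C `&` [set x | dot x (m i) = 0] &
    exists2 c, 0 < c & m i = c *: normal C j.
  (* The crossing point of that segment, up to a positive factor. *)
  apply: (@facet_of_active _ (mem I) m C i (dot y (m i) *: c - dot c (m i) *: y)) => //.
  - exact: mI0.
  - by rewrite dotDl dotNl !dotZl mulrC subrr.
  - move=> l lI li; rewrite dotDl dotNl !dotZl.
    have h1 : dot y (m i) * dot c (m l) < 0 by rewrite pmulr_rlt0 ?cI.
    have h2 : 0 <= dot c (m i) * dot y (m l) by rewrite mulr_le0 ?yl// ltW ?cI.
    lra.
by rewrite dotZr pmulr_rle0.
Qed.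

Lemma independent_normal (C : faced_cone R 3) : independent (normal C).
Proof. by rewrite /independent -(det3_ordS _ 0) lt_eqF// normal_cyclic. Qed.

(** The plane orthogonal to [normal C j] cuts out some face of C, whose normal is
parallel to [normal C j]; independence of the normals leaves only the j-th. *)
Lemma face_normals (C : faced_cone R 3) j :
  face C j = C `&` [set x | dot x (normal C j) = 0].
Proof.
have n0 := independent_normal C; pose w := dual_basis (normal C).
have wn i l : dot (w i) (normal C l) = (l == i)%:R by rewrite dotC dot_dual.
have nj0 i : normal C i != 0.
  by apply: contra_eq_neq (wn i i) => ->; rewrite dotC dot0l eqxx eq_sym oner_eq0.
have [|||||i fi [c c0 njE]] := @facet_of_active _ predT (normal C) C j
    (- (w (ordS j) + w (ordS (ordS j)))).
- rewrite cone_normals; apply/seteqP; split => x /= h l.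
    by move=> _; exact: h.
  exact: h.
- by [].
- exact: nj0.
- rewrite dotNl dotDl !wn -!val_eqE; case: j => -[|[|[|//]]] hj /=;
  by rewrite addr0 oppr0.
- move=> l _ lj; rewrite dotNl dotDl !wn.
  case: (ord3P j l) lj => -> //; first by rewrite eqxx.
    by rewrite eqxx ltrNl oppr0 ltr_pwDl.
  by rewrite eqxx ltrNl oppr0 ltr_wpDl.
suff ji : j = i by rewrite {1}ji fi.
apply/eqP; have := wn j j; rewrite eqxx njE dotZr wn.
by rewrite eq_sym; case: eqP => // _ /eqP; rewrite mulr0 eq_sym oner_eq0.
Qed.

(** Otherwise the truncation contains the whole ray opposite to the i-th dual
vector, along which x . xi is nonnegative. *)
Lemma coef_pos_of_pyramid (xi : vec) (C : faced_cone R 3) i :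
  is_pyramid xi C -> 0 < dot xi (dual_basis (normal C) i).
Proof.
move=> [_ [M [Mreal bM]]]; have n0 := independent_normal C.
set w := dual_basis (normal C) i; rewrite ltNge; apply/negP => xw.
have wn l : dot w (normal C l) = (l == i)%:R by rewrite dotC dot_dual.
have w0 : w != 0.
  by apply: contra_eq_neq (wn i) => ->; rewrite dot0l eqxx eq_sym oner_eq0.
have w0' : 0 < `|w| by rewrite normr_gt0.
have M1 : M < `|M| + 1 by rewrite (le_lt_trans (ler_norm M))// ltrDl.
pose s := (`|M| + 2) / `|w|.
have s0 : 0 <= s by rewrite divr_ge0// addr_ge0.
have bound x : truncation xi C x -> `|x| <= `|M| + 1 := bM _ M1 x.
have : `|- s *: w| <= `|M| + 1.
  apply: bound; split.
    rewrite cone_normals => l; rewrite dotZl wn mulNr oppr_le0.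
    by rewrite mulr_ge0.
  by rewrite /= dotZl (dotC w) mulNr; have := mulr_ge0_le0 s0 xw; lra.
rewrite normrZ normrN ger0_norm// divfK ?gt_eqF//; lra.
Qed.

(** The polar cone contains the vectors with positive coordinates in the basis
of normals, and these form an open set. *)
Lemma interior_polar (xi : vec) (C : faced_cone R 3) :
  (forall i, 0 < dot xi (dual_basis (normal C) i)) -> (polar C)° xi.
Proof.
move=> h; have n0 := independent_normal C.
have : \forall x \near xi, forall i, 0 < dot x (dual_basis (normal C) i).
  apply: (filter_forall (nbhs_filter xi)) => i.
  by apply: (cvgr_gt (dot xi (dual_basis (normal C) i))); [exact: dot_continuous|exact: h].
apply: filterS => x xw y; rewrite cone_normals => yn.
rewrite (dual_expansion y n0) dotC dot_suml sumr_le0// => i _.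
by rewrite dotZl mulr_le0_ge0// ?yn// dotC ltW.
Qed.
End Cones.

(** * Areas of the faces of a pyramid *)

Section Pyramid.
Context {R : realType}.
Notation vec := 'rV[R]_3.
Variables (C : faced_cone R 3) (xi : vec).
Let n := normal C.
Let b i := dot xi (dual_basis n i).
Hypothesis b_gt0 : forall i, 0 < b i.

(** The vertex of the base that does not lie on the i-th face. It is locked so
that rewriting with [dotZl] and [scalerA] does not unfold it. *)
Definition vertex i : vec := locked (- (b i)^-1 *: dual_basis n i).
Let p := vertex.
Let n0 : independent n := independent_normal C.
Let b_neq0 i : b i != 0. Proof. by rewrite gt_eqF. Qed.

Let dot_vertex_normal i l : dot (p i) (n l) = - (b i)^-1 * (l == i)%:R.
Proof. by rewrite /p /vertex -lock dotZl dotC dot_dual. Qed.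

Let dot_vertex i : dot (p i) xi = -1.
Proof. by rewrite /p /vertex -lock dotZl dotC mulNr mulVf. Qed.

Let vertex_expansion x : x = \sum_i (- b i * dot x (n i)) *: p i.
Proof.
rewrite {1}(dual_expansion x n0); apply: eq_bigr => i _.
by rewrite /p /vertex -lock [RHS]scalerA; congr (_ *: _); field; exact: b_neq0.
Qed.

Let cone_dot_le0 x j : cone C x -> dot x (n j) <= 0.
Proof. by rewrite cone_normals; exact. Qed.

Let cone_vertex (t : 'I_3 -> R) : (forall i, 0 <= t i) -> cone C (\sum_i t i *: p i).
Proof.
move=> t0; rewrite cone_normals => j.
rewrite dot_suml sumr_le0// => i _; rewrite dotZl dot_vertex_normal.
by rewrite mulNr mulrN oppr_le0 !mulr_ge0// invr_ge0 ltW.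
Qed.

Lemma face_truncation j : face C j `&` truncation xi C =
  triangle 0 (p (ordS j)) (p (ordS (ordS j))).
Proof.
apply/seteqP; split => x.
- rewrite face_normals => -[[Cx /= xj] [_ /= xxi]].
  have xE := vertex_expansion x; rewrite (sum3 _ j) xj mulr0 scale0r add0r in xE.
  eexists _, _; split; last by rewrite add0r; exact: xE.
  + by rewrite mulNr oppr_ge0 pmulr_rle0// cone_dot_le0.
  + by rewrite mulNr oppr_ge0 pmulr_rle0// cone_dot_le0.
  + by move: xxi; rewrite {1}xE dotDl !dotZl !dot_vertex; lra.
- move=> [s [t [s0 t0 st ->]]]; rewrite add0r.
  pose f i := if i == j then 0 else if i == ordS j then s else t.
  have fE : s *: p (ordS j) + t *: p (ordS (ordS j)) = \sum_i f i *: p i.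
    rewrite (sum3 _ j) /f eqxx scale0r add0r eqxx.
    by case: (j) => -[|[|[|//]]] ?; rewrite -!val_eqE.
  have CE : cone C (\sum_i f i *: p i).
    by apply: cone_vertex => i; rewrite /f; case: ifP => // _; case: ifP.
  split; last split; rewrite ?face_normals fE //.
    split=> //=; rewrite -fE dotDl !dotZl !dot_vertex_normal.
    by case: (j) => -[|[|[|//]]] ?; rewrite -!val_eqE /= !mulr0 addr0.
  by rewrite /= -fE dotDl !dotZl !dot_vertex; lra.
Qed.

Lemma base_triangle : base_face xi C = triangle (p 0) (p 1 - p 0) (p 2%:R - p 0).
Proof.
have [e1 e2] : 1 = ordS 0 :> 'I_3 /\ 2%:R = ordS 1 :> 'I_3.
  by split; apply: val_inj.
apply/seteqP; split => x.
- move=> [Cx /= xxi].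
  have := vertex_expansion x; rewrite (sum3 _ 0) -e1 -e2.
  set r := - _ * _; set s := - _ * _; set t := - _ * _ => xE.
  have [r0 s0 t0] : [/\ 0 <= r, 0 <= s & 0 <= t].
    by rewrite /r /s /t !mulNr !oppr_ge0 !pmulr_rle0// !cone_dot_le0.
  have rE : r = 1 - s - t by move: xxi; rewrite xE !dotDl !dotZl !dot_vertex; lra.
  exists s, t; split => //; first by lra.
  by rewrite xE rE; apply/rowP => i; rewrite !mxE; ring.
- move=> [s [t [s0 t0 st ->]]].
  pose f (i : 'I_3) : R := if i == 0 then 1 - s - t else if i == 1 then s else t.
  have -> : p 0 + s *: (p 1 - p 0) + t *: (p 2%:R - p 0) = \sum_i f i *: p i.
    rewrite (sum3 _ 0) -e1 -e2 /f /=.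
    by apply/rowP => i; rewrite !mxE; ring.
  split.
    by apply: cone_vertex => i; rewrite /f; case: ifP => // _; [lra|case: ifP].
  by rewrite /= dot_suml (sum3 _ 0) -e1 -e2 /f /= !dotZl !dot_vertex; lra.
Qed.

(** The area of the base when xi is a unit vector ([area_base]). *)
Definition area_scale : R :=
  `|det3 (n 0) (n 1) (n 2%:R) * (b 0 * b 1 * b 2%:R)|^-1 / 2.

Let den j : b 0 * b 1 * b 2%:R = b j * b (ordS j) * b (ordS (ordS j)).
Proof.
have -> : b 0 * b 1 * b 2%:R = b 0 * b (ordS 0) * b (ordS (ordS 0)).
  by congr (b _ * b _ * b _); apply: val_inj.
by case: (ord3P 0 j) => ->; rewrite ?ordS3; ring.
Qed.

Let D := det3 (n 0) (n 1) (n 2%:R).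

Let cross_vertex j : cross (p (ordS j)) (p (ordS (ordS j))) =
  (b j / (D * (b 0 * b 1 * b 2%:R))) *: n j.
Proof.
rewrite /p /vertex -!lock crossZ cross_dual// scalerA; congr (_ *: _).
rewrite (den j) -/D; field.
by have D0 : D != 0 := n0; rewrite !b_neq0 D0.
Qed.

Lemma area_scale_gt0 : 0 < area_scale.
Proof.
have D0 : D != 0 := n0.
by rewrite divr_gt0// invr_gt0 normr_gt0 !mulf_neq0.
Qed.

(** The area is half the length of the cross product of the two vertices of the
face, which is a multiple of the unit normal; the missing factor b_j in its
denominator is what makes it proportional to b_j. *)
Lemma area_face j : area (face C j `&` truncation xi C) = area_scale * b j.
Proof.
have gE : gram_det (p (ordS j)) (p (ordS (ordS j))) = (area_scale * b j * 2) ^+ 2.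
  rewrite gram_cross cross_vertex dotZl dotZr.
  have /unit_dot -> := normal_unit C j.
  rewrite mulr1 -expr2 -[LHS]real_normK ?num_real// normrM normfV.
  rewrite (gtr0_norm (b_gt0 j)) /area_scale -/D; congr (_ ^+ 2).
  by move: (`|_|^-1) => u; field.
have h0 : 0 < area_scale * b j * 2 by rewrite mulr_gt0// mulr_gt0// area_scale_gt0.
rewrite face_truncation area_triangle gE ?exprn_gt0// sqrtr_sqr gtr0_norm//.
by field.
Qed.

(** The cross product of two edges of the base is the sum of the three cross
products of its vertices, which is, up to a common factor, the sum of the
b_j n_j, that is xi. *)
Lemma area_base : unit_vec xi -> area (base_face xi C) = area_scale.
Proof.
move=> /unit_dot xi1.
have gE : gram_det (p 1 - p 0) (p 2%:R - p 0) = (area_scale * 2) ^+ 2.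
  have [e1 e2] : 1 = ordS 0 :> 'I_3 /\ 2%:R = ordS 1 :> 'I_3.
    by split; apply: val_inj.
  rewrite gram_cross cross_sub.
  have -> : cross (p 1) (p 2%:R) + cross (p 2%:R) (p 0) + cross (p 0) (p 1) =
      (D * (b 0 * b 1 * b 2%:R))^-1 *: xi.
    have e0 : 0 = ordS 2%:R :> 'I_3 by apply: val_inj.
    have c0 := cross_vertex 0; rewrite -e1 -e2 in c0.
    have c1 := cross_vertex 1; rewrite -e2 -e0 in c1.
    have c2 := cross_vertex 2%:R; rewrite -e0 -e1 in c2.
    rewrite c0 c1 c2 [in RHS](basis_expansion xi n0) scaler_sumr (sum3 _ 0) -e1 -e2.
    by rewrite !scalerA; congr (_ *: _ + _ *: _ + _ *: _); rewrite mulrC.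
  rewrite dotZl dotZr xi1 mulr1 -expr2 -[LHS]real_normK ?num_real// normfV.
  by rewrite /area_scale divfK.
have h0 : 0 < area_scale * 2 by rewrite mulr_gt0// area_scale_gt0.
rewrite base_triangle area_triangle gE ?exprn_gt0// sqrtr_sqr gtr0_norm//.
by field.
Qed.
End Pyramid.

(** * Dihedral angles and isometries *)

Section Comparison.
Context {R : realType}.
Notation vec := 'rV[R]_3.
Implicit Types (u v : vec) (n : 'I_3 -> vec).

(** The Cauchy-Schwarz inequality: a Gram determinant is a squared length. *)
Lemma unit_dot_itv u v : unit_vec u -> unit_vec v -> -1 <= dot u v <= 1.
Proof.
move=> /unit_dot u1 /unit_dot v1; rewrite -ler_norml -(@ler_sqr _ _ 1) ?nnegrE//.
rewrite real_normK ?num_real// expr1n -subr_ge0.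
by have := dot_ge0 (cross u v); rewrite -gram_cross /gram_det u1 v1 mulr1.
Qed.

Lemma angle_unit u v : unit_vec u -> unit_vec v -> angle u v = acos (dot u v).
Proof. by rewrite /angle => -> ->; rewrite mulr1 divr1. Qed.

Lemma cos_angle u v : unit_vec u -> unit_vec v -> cos (angle u v) = dot u v.
Proof.
by move=> u1 v1; rewrite angle_unit// acosK// in_itv/= unit_dot_itv.
Qed.

(** The cosine decreases on [0, pi]. *)
Lemma dot_le_of_dihedral (C Cbar : faced_cone R 3) j :
  dihedral C j <= dihedral Cbar j ->
  dot (normal C j) (normal C (ordS j)) <= dot (normal Cbar j) (normal Cbar (ordS j)).
Proof.
have nu i := normal_unit C i; have nbu i := normal_unit Cbar i.
rewrite /dihedral lerD2l lerN2 -(cos_angle (nu _) (nu _)) -(cos_angle (nbu _) (nbu _)).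
move=> h; rewrite leNgt; apply/negP => hc; move: h; apply/negP; rewrite -ltNge.
move: hc; rewrite ltr_cos // in_itv/= angle_unit// ?acos_ge0 ?acos_lepi ?unit_dot_itv//.
Qed.

(** Among three indices, every unordered pair is of the form j, j + 1 modulo 3
for exactly one j. *)
Lemma sqr_sum_normals (n : 'I_3 -> vec) (b : 'I_3 -> R) :
  (forall i, unit_vec (n i)) ->
  dot (\sum_i b i *: n i) (\sum_i b i *: n i) =
  \sum_i b i ^+ 2 + 2 * \sum_i b i * b (ordS i) * dot (n i) (n (ordS i)).
Proof.
move=> nu; have n1 i : dot (n i) (n i) = 1 by apply/unit_dot.
rewrite !(sum3 _ 0) !ordS3.
rewrite !(dotDl, dotDr, dotZl, dotZr) !n1.
rewrite (dotC (n (ordS (ordS 0))) (n 0)) (dotC (n (ordS 0)) (n 0)).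
rewrite (dotC (n (ordS (ordS 0))) (n (ordS 0))).
ring.
Qed.

(** The normals of the two cones are bases with the same Gram matrix, so the
linear map carrying one basis to the other is orthogonal; it carries one
half-space description to the other. *)
Lemma isometric_of_dot (C Cbar : faced_cone R 3) :
  (forall j, dot (normal C j) (normal C (ordS j)) =
             dot (normal Cbar j) (normal Cbar (ordS j))) ->
  isometric C Cbar.
Proof.
move=> dotE'.
have gramE i j : dot (normal C i) (normal C j) = dot (normal Cbar i) (normal Cbar j).
  case: (ord3P i j) => ->.
  - have /unit_dot -> := normal_unit C i; by have /unit_dot -> := normal_unit Cbar i.
  - exact: dotE'.
  - by have := dotE' (ordS (ordS i)); rewrite ordS3 dotC => ->; rewrite dotC.
pose N (D : faced_cone R 3) : 'M[R]_3 := \matrix_i normal D i.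
have Nunit D : N D \in unitmx.
  rewrite unitmxE unitfE; have := independent_normal D; rewrite /independent /det3.
  congr (\det _ != 0); apply/matrixP => i j; rewrite !mxE.
  by case: i => -[|[|[|//]]] hi /=; congr (normal D _ _ _); apply: val_inj.
have NN D i j : (N D *m (N D)^T) i j = dot (normal D i) (normal D j).
  by rewrite mxE /dot; apply: eq_bigr => k _; rewrite !mxE.
have NE : N C *m (N C)^T = N Cbar *m (N Cbar)^T.
  by apply/matrixP => i j; rewrite !NN gramE.
have memE (D : faced_cone R 3) x : cone D x <-> forall j, (x *m (N D)^T) 0 j <= 0.
  have xN j : (x *m (N D)^T) 0 j = dot x (normal D j).
    by rewrite mxE /dot; apply: eq_bigr => k _; rewrite !mxE.
  by rewrite cone_normals; split=> h j; have := h j; rewrite xN.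
pose M := invmx (N Cbar) *m N C.
have MM : M *m M^T = 1%:M.
  rewrite trmx_mul trmx_inv mulmxA -(mulmxA _ (N C)) NE mulmxA mulVmx// mul1mx.
  by rewrite mulmxV// unitmx_tr.
exists M^T; first by rewrite trmxK; apply: mulmx1C.
have MN : M *m (N C)^T = (N Cbar)^T.
  by rewrite /M -mulmxA NE mulmxA mulVmx// mul1mx.
rewrite trmxK; apply/seteqP; split => [_ [x /memE xC <-]|x /memE xC].
  by apply/memE => j; rewrite -mulmxA MN.
exists (x *m M^T); last by rewrite -mulmxA (mulmx1C MM) mulmx1.
by apply/memE => j; rewrite -MN mulmxA -(mulmxA x) (mulmx1C MM) mulmx1.
Qed.

End Comparison.

(** * The comparison pyramid *)

Theorem proposition3p14 (R : realType) (Cbar : faced_cone R 3)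
    (xibar : 'rV[R]_3) (C : faced_cone R 3) :
  is_pyramid xibar Cbar ->
  less_dihedral_angle C Cbar ->
  (exists xi : 'rV[R]_3,
     [/\ unit_vec xi, (polar C)° xi & energy xibar Cbar xi C <= 0]) /\
  (~ isometric C Cbar ->
   exists xi : 'rV[R]_3,
     [/\ unit_vec xi, (polar C)° xi & energy xibar Cbar xi C < 0]).
Proof.
move=> pyr less; have xb1 : unit_vec xibar by case: pyr.
have n0 := independent_normal C; have nb0 := independent_normal Cbar.
pose b i := dot xibar (dual_basis (normal Cbar) i).
have b0 i : 0 < b i by exact: coef_pos_of_pyramid.
have xbE : xibar = \sum_i b i *: normal Cbar i by exact: basis_expansion.
(* The area proportions of the reference pyramid, on the normals of C. *)
pose y := \sum_i b i *: normal C i.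
have yw i : dot y (dual_basis (normal C) i) = b i.
  rewrite dot_suml (bigD1 i)//= big1 ?addr0 => [|l li]; rewrite dotZl dot_dual//.
    by rewrite eqxx mulr1.
  by rewrite (negbTE li) mulr0.
have y0 : y != 0 by apply: contraTneq (b0 0) => y0; rewrite -yw y0 dot0l ltxx.
pose r := enorm y; pose xi := r^-1 *: y.
have r0 : 0 < r by rewrite /r /enorm sqrtr_gt0 dot_gt0.
have xi1 : unit_vec xi by exact: unit_normalize.
have xiw i : dot xi (dual_basis (normal C) i) = r^-1 * b i by rewrite dotZl yw.
have xiw0 i : 0 < dot xi (dual_basis (normal C) i) by rewrite xiw mulr_gt0// invr_gt0.
have xipol := interior_polar xiw0.
have energyE : energy xibar Cbar xi C = area_scale C xi * (1 - r^-1).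
  rewrite /energy (area_base xiw0 xi1).
  have -> : \sum_(j < 3) cos (angle (normal Cbar j) xibar) *
      area (face C j `&` truncation xi C) = area_scale C xi * r^-1 * dot xibar xibar.
    rewrite {2}xbE dot_suml mulr_sumr; apply: eq_bigr => j _.
    rewrite (area_face xiw0) xiw cos_angle//; last exact: normal_unit.
    by rewrite dotZl; ring.
  by move/unit_dot : xb1 => ->; ring.
have h0 := area_scale_gt0 xiw0.
pose gap j := b j * b (ordS j) *
  (dot (normal Cbar j) (normal Cbar (ordS j)) - dot (normal C j) (normal C (ordS j))).
have gap0 j : 0 <= gap j.
  apply: mulr_ge0; first by rewrite mulr_ge0// ltW.
  by rewrite subr_ge0; exact: dot_le_of_dihedral.
have rE : 1 - r ^+ 2 = 2 * \sum_j gap j.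
  rewrite sqr_enorm /y sqr_sum_normals; last exact: normal_unit.
  rewrite -[X in X - _](proj1 (unit_dot xibar) xb1) xbE.
  rewrite sqr_sum_normals; last exact: normal_unit.
  rewrite opprD addrACA subrr add0r -mulrBr -sumrB; congr (2 * _).
  by apply: eq_bigr => j _; rewrite -mulrBr.
split=> [|niso]; exists xi; split => //; rewrite energyE.
- rewrite pmulr_rle0// subr_le0 invf_ge1// -(@ler_sqr _ r 1) ?nnegrE ?(ltW r0)//.
  by rewrite expr1n -subr_ge0 rE mulr_ge0// sumr_ge0.
- rewrite pmulr_rlt0// subr_lt0 invf_gt1// -(@ltr_sqr _ r 1) ?nnegrE ?(ltW r0)//.
  rewrite expr1n -subr_gt0 rE mulr_gt0// lt_def sumr_ge0// andbT.
  apply/negP => /eqP /psumr_eq0P gapz; apply: niso; apply: isometric_of_dot => j.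
  have := gapz (fun i _ => gap0 i) j isT; move=> /eqP.
  by rewrite mulf_eq0 gt_eqF ?mulr_gt0//= subr_eq0 => /eqP.
Qed.
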